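(* Let $\mathbb{F}_q$ be the finite field with $q$ elements, let $n\ge 1$, let $R=\operatorname{map}(\mathbb{A}^n(\mathbb{F}_q),\mathbb{F}_q)$ be the finite set of all functions $\mathbb{A}^n(\mathbb{F}_q)\to\mathbb{F}_q$, equipped with the uniform probability measure $P$, and let $\gamma_q\colon R\to[0,1]$ be the random variable $\gamma_q(f)=|\{x\in\mathbb{A}^n(\mathbb{F}_q) : f(x)=0\}|/q^n$. Then the distribution of $\gamma_q$ on $R$ is binomial: for every integer $0\le k\le q^n$, \[ P\left(\gamma_q=\frac{k}{q^n}\right)=\mathcal{B}\left(q^n,\frac1q,k\right). \] In particular the expectation value of $\gamma_q$ is $E(\gamma_q)=\frac1q$.
   Context: $\mathbb{A}^n(\mathbb{F}_q)=\mathbb{F}_q^n$ is the set of $\mathbb{F}_q$-rational points of affine $n$-space. The binomial distribution is denoted $\mathcal{B}(N,p,k)=\binom{N}{k}p^k(1-p)^{N-k}$, where $N$ is the number of trials, $p$ the success probability and $k$ the number of successes. *)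

(* Defs.v *)
From HB Require Import structures.
From mathcomp Require Import all_boot all_order all_algebra.
From mathcomp Require Import all_classical all_reals all_analysis.

Set Implicit Arguments.
Unset Strict Implicit.
Unset Printing Implicit Defensive.

Import Order.TTheory GRing.Theory Num.Theory.

Local Open Scope classical_set_scope.
Local Open Scope ring_scope.

(* All set-theoretic maps from affine n-space to F (not only affine-linear
   ones).  The alias lets this finite type carry the discrete sigma-algebra:
   every set of maps is an event. *)
Definition affine_space_map (F : finFieldType) (n : nat) : Type :=
  {ffun 'rV[F]_n -> F}.

HB.instance Definition _ (F : finFieldType) (n : nat) :=
  Finite.on (affine_space_map F n).

HB.instance Definition _ (F : finFieldType) (n : nat) :=
  isPointed.Build (affine_space_map F n) [ffun=> 0].

HB.instance Definition _ (F : finFieldType) (n : nat) :=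
  @isMeasurable.Build default_measure_display (affine_space_map F n)
    discrete_measurable discrete_measurable0
    discrete_measurableC discrete_measurableU.

Definition uniform_map_prob (R : realType) (F : finFieldType) (n : nat) :
    set (affine_space_map F n) -> \bar R :=
  mscale (#|{: affine_space_map F n}|%:R^-1)%:nng counting.

HB.instance Definition _ (R : realType) (F : finFieldType) (n : nat) :=
  Measure.on (@uniform_map_prob R F n).

Lemma uniform_map_probE (R : realType) (F : finFieldType) (n : nat)
    (A : set (affine_space_map F n)) :
  @uniform_map_prob R F n A =
  (#|[set f : affine_space_map F n | f \in A]%SET|%:R / #|{: affine_space_map F n}|%:R)%:E.
Proof.
rewrite /uniform_map_prob /mscale /= /counting.
case: asboolP => [_|[]]; last exact: finite_finset.
rewrite -EFinM mulrC; congr ((_%:R / _)%:E); rewrite [RHS]cardE.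
apply/perm_size/uniq_perm => [||f]; [exact: finmap.fset_uniq|exact: enum_uniq|].
by rewrite in_fset_set ?mem_enum ?inE //; exact: finite_finset.
Qed.

Lemma uniform_map_probT (R : realType) (F : finFieldType) (n : nat) :
  @uniform_map_prob R F n setT = 1%E.
Proof.
rewrite uniform_map_probE cardsE (eq_card (B := predT)) => [|f].
  by rewrite divff // pnatr_eq0 -lt0n; apply/card_gt0P; exists point.
exact: mem_set.
Qed.

HB.instance Definition _ (R : realType) (F : finFieldType) (n : nat) :=
  @Measure_isProbability.Build _ _ R (@uniform_map_prob R F n)
    (@uniform_map_probT R F n).

Arguments uniform_map_prob R F n : clear implicits.

Definition zero_ratio (R : realType) (F : finFieldType) (n : nat)
    (f : affine_space_map F n) : R :=
  #|[set x : 'rV[F]_n | f x == 0]%SET|%:R / (#|F| ^ n)%:R.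

Lemma measurable_zero_ratio (R : realType) (F : finFieldType) (n : nat) :
  measurable_fun setT (@zero_ratio R F n).
Proof. by []. Qed.

HB.instance Definition _ (R : realType) (F : finFieldType) (n : nat) :=
  isMeasurableFun.Build _ _ (affine_space_map F n) R (@zero_ratio R F n)
    (@measurable_zero_ratio R F n).

Arguments zero_ratio R F n : clear implicits.

Definition gamma (R : realType) (F : finFieldType) (n : nat) :
  {RV uniform_map_prob R F n >-> R} := zero_ratio R F n.

Lemma gamma_itv (R : realType) (F : finFieldType) (n : nat)
    (f : affine_space_map F n) :
  gamma R F n f \in `[0, 1].
Proof.
have q0 : (0 < #|F| ^ n)%N by rewrite expn_gt0 -cardsT (cardsD1 0) inE.
rewrite in_itv /= divr_ge0 //= ler_pdivrMr ?ltr0n // mul1r ler_nat.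
by rewrite (leq_trans (max_card _)) // card_mx mul1n.
Qed.

(* Main.v *)
(* A map with exactly k zeros is a choice of its zero set, among C(q^n, k), and
   of a nonzero value at each of the other points, which gives
   C(q^n, k) (q - 1)^(q^n - k) maps.  For the expectation, gamma is the average
   over x of the indicators of the events f(x) = 0, each of probability 1/q. *)
Require Import Defs.
From mathcomp Require Import all_boot all_order all_algebra.
From mathcomp Require Import all_classical all_reals all_analysis.

Import Order.TTheory GRing.Theory Num.Theory.

Local Open Scope classical_set_scope.
Local Open Scope ring_scope.

(** These functions form a product set, a [family]: the value is forced to be [z] at each point of
    [A] and ranges over the [#|U|.-1] other elements elsewhere. *)
Lemma card_ffun_preim1_set (T U : finType) (z : U) (A : {set T}) :
  #|[set f : {ffun T -> U} | [set x | f x == z]%SET == A]%SET| =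
  (#|U|.-1 ^ (#|T| - #|A|))%N.
Proof.
rewrite (_ : #|_| = #|family (fun x => if x \in A then pred1 z else predC1 z)|).
  rewrite card_family foldrE big_image /= (bigID (mem A)) /=.
  rewrite big1 ?mul1n => [|x ->]; last by rewrite card1.
  rewrite (eq_bigr (fun=> #|U|.-1)) => [|x /negPf ->]; last first.
    by rewrite cardC1.
  rewrite prod_nat_const; congr (_ ^ _)%N.
  by rewrite -(cardC (mem A)) addKn; apply: eq_card.
apply: eq_card => f; rewrite !inE; apply/eqP/familyP => [<- x|fA].
  by rewrite inE; case: ifP => [/eqP ->|]; rewrite !inE // => ->.
apply/setP => x; move: (fA x); rewrite inE.
by case: ifP; rewrite !inE // => _ /negPf.
Qed.

(** Grouping the functions by their fibre over [z] gives one class per [k]-element subset of [T],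
    and all classes have the same size by [card_ffun_preim1_set]. *)
Lemma card_ffun_card_preim1 (T U : finType) (z : U) (k : nat) :
  #|[set f : {ffun T -> U} | #|[set x | f x == z]%SET| == k]%SET| =
  ('C(#|T|, k) * #|U|.-1 ^ (#|T| - k))%N.
Proof.
rewrite -sum1_card (partition_big
  (fun f : {ffun T -> U} => [set x | f x == z]%SET)
  (fun A : {set T} => #|A| == k)) /= => [|f]; last by rewrite inE.
rewrite -card_draws -sum_nat_const big_mkcond [RHS]big_mkcond /=.
apply: eq_bigr => A _; rewrite inE; case: eqP => // Ak.
rewrite -Ak -(card_ffun_preim1_set _ _ z) -[RHS]sum1_card; apply: eq_bigl => f.
(* Within the class of [A] the cardinality condition is automatic, since [#|A| = k]. *)
by rewrite !inE andb_idl // => /eqP ->; rewrite Ak.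
Qed.

(** Only the value at [x] is constrained; the other [#|T|.-1] values are free. *)
Lemma card_ffun_eval (T U : finType) (z : U) (x : T) :
  #|[set f : {ffun T -> U} | f x == z]%SET| = (#|U| ^ #|T|.-1)%N.
Proof.
rewrite (_ : #|_| = #|family (fun y => if y == x then pred1 z else predT)|).
  rewrite card_family foldrE big_image /= (bigD1 x) //= eqxx card1 mul1n.
  rewrite (eq_bigr (fun=> #|U|)) => [|y /negPf -> //].
  by rewrite prod_nat_const -(cardC1 x).
apply: eq_card => f; rewrite !inE; apply/eqP/familyP => [fx y|/(_ x)].
  by case: eqP => [->|] //; rewrite inE fx.
by rewrite eqxx => /eqP.
Qed.

Theorem proposition2p8 (R : realType) (F : finFieldType) (n : nat)
    (n_ge1 : (1 <= n)%N) :
  (forall k : nat, (k <= #|F| ^ n)%N ->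
     uniform_map_prob R F n
       [set f : affine_space_map F n | gamma R F n f = k%:R / (#|F| ^ n)%:R] =
     (binomial_pmf (#|F| ^ n) (#|F|%:R^-1) k)%:E) /\
  ('E_(uniform_map_prob R F n)[gamma R F n] = (#|F|%:R^-1)%:E)%E.
Proof.
have q0 : (0 < #|F|)%N by apply/card_gt0P; exists 0.
have N0 : (0 < #|F| ^ n)%N by rewrite expn_gt0 q0.
have q0R : #|F|%:R != 0 :> R by rewrite pnatr_eq0 -lt0n.
have N0R : (#|F| ^ n)%:R != 0 :> R by rewrite pnatr_eq0 -lt0n.
have cardV : #|{: 'rV[F]_n}| = (#|F| ^ n)%N by rewrite card_mx mul1n.
have cardM : #|{: affine_space_map F n}| = (#|F| ^ (#|F| ^ n))%N.
  by rewrite card_ffun cardV.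
split=> [k kN|].
  rewrite uniform_map_probE cardM; congr EFin.
  rewrite (_ : #|_| = 'C(#|F| ^ n, k) * #|F|.-1 ^ (#|F| ^ n - k))%N; last first.
    rewrite -cardV -(card_ffun_card_preim1 _ _ (0 : F)); apply: eq_card => f.
    rewrite !inE; apply/asboolP/eqP => [|<-].
      (* Cancelling the nonzero denominator leaves an equality of naturals cast into [R], which has
         characteristic zero. *)
      rewrite /= /zero_ratio cardV => /(mulIf (invr_neq0 N0R))/eqP.
      by rewrite eqr_nat => /eqP.
    by rewrite /= cardV.
  have q1 : unstable.onem (#|F|%:R^-1) = #|F|.-1%:R / #|F|%:R :> R.
    apply: (mulIf q0R); rewrite /unstable.onem divfK // mulrBl mul1r mulVf //.
    by rewrite -subn1 natrB.
  rewrite /binomial_pmf q1 expr_div_n exprVn natrM !natrX.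
  (* The denominators [q^k] and [q^(q^n - k)] combine into [q^(q^n)], the number of maps; this needs
     [k <= q^n]. *)
  by rewrite mulrCA -invfM -exprD subnKC // -[in LHS]mulrA mulr_natl.
have PE (x : 'rV[F]_n) :
    uniform_map_prob R F n [set f | f x = 0] = (#|F|%:R^-1)%:E.
  rewrite uniform_map_probE cardM; congr EFin.
  rewrite (_ : #|_| = (#|F| ^ (#|F| ^ n).-1)%N).
    (* One factor [q] is split off the total [q^(q^n)]; the rest cancels against the count of maps
       vanishing at [x]. *)
    rewrite -[in X in _ / X](prednK N0) expnS natrM invfM mulrCA.
    by rewrite divff ?mulr1 // natrX expf_neq0.
  rewrite -cardV -(card_ffun_eval _ _ (0 : F) x); apply: eq_card => f.
  by rewrite !inE; apply/asboolP/eqP.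
rewrite unlock.
rewrite (_ : (fun f => _) = (fun f : affine_space_map F n =>
    (#|F| ^ n)%:R^-1%:E *
    \sum_(x : 'rV[F]_n)
      (\1_[set f : affine_space_map F n | f x = 0] f)%:E)%E); last first.
  apply/funext => f; rewrite sumEFin -EFinM mulrC; congr (_ / _)%:E.
  rewrite -sum1_card natr_sum big_mkcond /=; apply: eq_bigr => x _.
  rewrite indicE inE.
  by case: (f x =P 0) => fx; [rewrite mem_set|rewrite memNset].
(* All terms are nonnegative, so the constant and the finite sum leave the integral without any
   integrability argument. *)
rewrite ge0_integralZl //; last by move=> f _; apply: sume_ge0.
rewrite ge0_integral_sum //.
rewrite (eq_bigr (fun=> (#|F|%:R^-1)%:E)) => [|x _]; last first.
  by rewrite integral_indic // setIT; exact: PE.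
by rewrite sumEFin sumr_const cardV -EFinM -[X in (_ * X)%:E]mulr_natl mulKf.
Qed.
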